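(* Let $L:\mathbb{R}^n\to[0,\infty)$ be a convex function such that $L(0)=0$ and $L(x)>0$ for $x\ne 0$. Then $L$ satisfies the two-sided $\Delta_2$-condition if and only if $$\sup_{x\ne 0}\frac{L'(x,x)}{L(x)}=\sup_{x\ne 0}\ \sup_{y\in\partial L(x)}\frac{\langle x,y\rangle}{L(x)}<\infty$$ (the two suprema being equal). In this case, both suprema are at most $p_+=\Phi_L'(1+)$. If $L$ is differentiable, this condition simplifies to $$\sup_{x\ne 0}\frac{\langle\nabla L(x),x\rangle}{L(x)}<\infty .$$
   Context: $L$ is said to satisfy the two-sided $\Delta_2$-condition if there is a constant $C$ such that $L(2x)\le C L(x)$ for all $x\in\mathbb{R}^n$. The directional derivative of $L$ at $x$ in the direction $\theta$ is $L'(x,\theta)=\lim_{\varepsilon\downarrow 0}\frac{L(x+\varepsilon\theta)-L(x)}{\varepsilon}$, for $x,\theta\in\mathbb{R}^n$. The subdifferential is $\partial L(x)=\{y\in\mathbb{R}^n: L(z)\ge L(x)+\langle y,z-x\rangle \text{ for all } z\in\mathbb{R}^n\}$. The function $\Phi_L$ is defined by $\Phi_L(r)=\sup_{x\ne 0}\frac{L(rx)}{L(x)}$, $r\ge 0$; under the two-sided $\Delta_2$-condition it is finite and convex on $[0,\infty)$, and $\Phi_L'(1+)$ denotes its right derivative at $1$. *)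

(* Defs.v *)
From HB Require Import structures.
From mathcomp Require Import all_boot all_order all_algebra.
From mathcomp Require Import all_classical all_reals all_analysis.

Set Implicit Arguments.
Unset Strict Implicit.
Unset Printing Implicit Defensive.

Import Order.TTheory GRing.Theory Num.Theory.
Import numFieldNormedType.Exports.

Local Open Scope classical_set_scope.
Local Open Scope ring_scope.

Definition dotprod (R : realType) (n : nat) (u v : 'rV[R]_n) : R :=
  \sum_(i < n) u ord0 i * v ord0 i.

Definition two_sided_Delta2 (R : realType) (n : nat) (L : 'rV[R]_n -> R) : Prop :=
  exists C : R, forall x : 'rV[R]_n, L (2 *: x) <= C * L x.

(* The limit exists for every convex L : 'rV_n -> R, because the difference
   quotient is then nondecreasing in e and bounded below. *)
Definition dir_deriv (R : realType) (n : nat) (L : 'rV[R]_n -> R)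
    (x theta : 'rV[R]_n) : R :=
  lim ((L (x + e *: theta) - L x) / e @[e --> 0^'+]).

Definition subdifferential (R : realType) (n : nat) (L : 'rV[R]_n -> R)
    (x : 'rV[R]_n) : set 'rV[R]_n :=
  [set y | forall z : 'rV[R]_n, L x + dotprod y (z - x) <= L z].

Definition gradient (R : realType) (n : nat) (L : 'rV[R]_n -> R)
    (x : 'rV[R]_n) : 'rV[R]_n :=
  \row_(i < n) 'D_(delta_mx ord0 i) L x.

Definition Phi (R : realType) (n : nat) (L : 'rV[R]_n -> R) (r : R) : \bar R :=
  ereal_sup [set (L (r *: x) / L x)%:E | x in [set x : 'rV[R]_n | x != 0]].

(* Right derivative at 1 of Phi L.  [fine] turns the values of Phi L into real
   numbers; it is meant to be used under the two-sided Delta_2-condition, where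
   Phi L is finite and convex on [0, +oo[, so that the limit exists. *)
Definition p_plus (R : realType) (n : nat) (L : 'rV[R]_n -> R) : R :=
  lim ((fine (Phi L (1 + e)) - fine (Phi L 1)) / e @[e --> 0^'+]).

Definition sup_dir_deriv (R : realType) (n : nat) (L : 'rV[R]_n -> R) : \bar R :=
  ereal_sup [set (dir_deriv L x x / L x)%:E | x in [set x : 'rV[R]_n | x != 0]].

Definition sup_subdiff (R : realType) (n : nat) (L : 'rV[R]_n -> R) : \bar R :=
  ereal_sup
    [set ereal_sup [set (dotprod x y / L x)%:E | y in subdifferential L x]
    | x in [set x : 'rV[R]_n | x != 0]].

Definition sup_gradient (R : realType) (n : nat) (L : 'rV[R]_n -> R) : \bar R :=
  ereal_sup [set (dotprod (gradient L x) x / L x)%:E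
            | x in [set x : 'rV[R]_n | x != 0]].

(* Main.v *)
Require Import Defs.
From HB Require Import structures.
From mathcomp Require Import all_boot all_order all_algebra.
From mathcomp Require Import all_classical all_reals all_analysis.
From mathcomp Require Import ring lra.

Set Implicit Arguments.
Unset Strict Implicit.
Unset Printing Implicit Defensive.

Import Order.TTheory GRing.Theory Num.Theory.
Import numFieldNormedType.Exports.

Local Open Scope classical_set_scope.
Local Open Scope ring_scope.

(** For convex [L] the one-sided derivative [L'(x, v)] is the infimum over
    [e > 0] of the difference quotients and is sublinear in [v].  Taking
    one-sided derivatives again along [x] and then along the basis vectors
    turns it into a linear functional below [L'(x, .)] with the same value at
    [x]; this subgradient shows that the two suprema agree.  Under Delta_2 the
    difference quotient at [e = 1] bounds [L'(x, x)], and the limit [e -> 0+]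
    gives the bound by [p_+].  Conversely, if [L'(x, x) <= M L(x)], a
    supporting hyperplane at [x] gives [L(x) <= 2 L((1 - 1/(2M)) x)], and
    iterating this bounds [L(2x)] by a multiple of [L(x)]. *)

(** * Difference quotients of a convex function *)

Section OneSidedDerivative.
Context {R : realType} {V : lmodType R}.
Implicit Types (f p q : V -> R) (x y v w : V) (a b e s t : R).

Definition jensen f := forall a b x y,
  0 <= a -> 0 <= b -> a + b = 1 -> f (a *: x + b *: y) <= a * f x + b * f y.

Lemma convex_function_jensen f : convex_function [set: V] f -> jensen f.
Proof.
move=> cf a b x y a0 b0 ab1.
have a1 : a <= 1 by lra.
have a01 : 0 <= a <= 1 by rewrite a0 a1.
have := cf (Itv01 a0 a1) x y (mem_setT _) (mem_setT _).
have -> : b = 1 - a by lra.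
by [].
Qed.

Definition diff_quot f x v e : R := (f (x + e *: v) - f x) / e.

(** The point [x + s *: v] is the convex combination of [x + t *: v] and [x] with weight [s / t] on
    the former. *)
Lemma diff_quot_nondecreasing f x v s t : jensen f ->
  0 < s -> s <= t -> diff_quot f x v s <= diff_quot f x v t.
Proof.
move=> cf s0 st; have t0 : 0 < t by lra.
have b0 : 0 <= 1 - s / t by rewrite subr_ge0 ler_pdivrMr// mul1r.
have := cf (s / t) (1 - s / t) (x + t *: v) x (ltW (divr_gt0 s0 t0)) b0.
rewrite scalerDr scalerA divfK ?gt_eqF// addrAC -scalerDl.
rewrite (addrC (s / t)) subrK scale1r => /(_ erefl) H.
rewrite /diff_quot ler_pdivrMr// mulrAC -mulrA mulrC.
move: H; set k := s / t; lra.
Qed.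

(** The point [x] lies between [x + e *: v] and [x - v], with weights [1 / (1 + e)] and
    [e / (1 + e)]. The resulting bound does not depend on [e], so the infimum below is a genuine
    one. *)
Lemma diff_quot_ge f x v e : jensen f -> 0 < e ->
  f x - f (x - v) <= diff_quot f x v e.
Proof.
move=> cf e0; have e1 : 0 < 1 + e by lra.
have := cf (1 + e)^-1 (e / (1 + e)) (x + e *: v) (x - v).
rewrite invr_ge0 (ltW e1) divr_ge0 ?(ltW e0) ?(ltW e1)// => /(_ isT isT).
have -> : (1 + e)^-1 *: (x + e *: v) + e / (1 + e) *: (x - v) = x.
  rewrite !scalerDr scalerN scalerA (mulrC _ e) addrACA subrr addr0 -scalerDl.
  by rewrite -[X in X + _]mul1r -mulrDl divff ?gt_eqF// scale1r.
have ab1 : (1 + e)^-1 + e / (1 + e) = 1.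
  by rewrite -[X in X + _]mul1r -mulrDl divff ?gt_eqF.
move=> /(_ ab1) H; rewrite /diff_quot ler_pdivlMr//.
have : (1 + e) * f x <= f (x + e *: v) + e * f (x - v).
  rewrite -ler_pdivlMl//; apply: le_trans H _.
  by rewrite mulrDr mulrCA mulrA.
lra.
Qed.

(** As an infimum it lies below every quotient and above every common lower bound; [diff_quot_cvg]
    identifies it with the limit at 0+ for convex [f]. *)
Definition one_sided_deriv f x v : R :=
  inf [set diff_quot f x v e | e in [set e | 0 < e]].

Lemma diff_quot_has_lbound f x v : jensen f ->
  has_lbound [set diff_quot f x v e | e in [set e | 0 < e]].
Proof.
by move=> cf; exists (f x - f (x - v)) => _ [e e0 <-]; exact: diff_quot_ge.
Qed.

Lemma one_sided_deriv_le f x v e : jensen f -> 0 < e ->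
  one_sided_deriv f x v <= diff_quot f x v e.
Proof.
by move=> cf e0; apply: ge_inf; [exact: diff_quot_has_lbound|exists e].
Qed.

Lemma one_sided_deriv_ge f x v (c : R) :
  (forall e, 0 < e -> c <= diff_quot f x v e) -> c <= one_sided_deriv f x v.
Proof.
move=> H; apply: lb_le_inf; first by exists (diff_quot f x v 1), 1 => /=.
by move=> _ [e e0 <-]; exact: H.
Qed.

Lemma diff_quot_cvg f x v : jensen f ->
  diff_quot f x v e @[e --> 0^'+] --> one_sided_deriv f x v.
Proof.
move=> cf; have -> : one_sided_deriv f x v =
    inf [set diff_quot f x v e | e in [set` Interval (BRight (0:R)) +oo%O]].
  by congr (inf (image _ _)); apply/seteqP; split=> e /=;
    rewrite in_itv/= andbT.
apply: nondecreasing_at_right_cvgr => //.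
  move=> s t; rewrite !in_itv/= !andbT => s0 _ st.
  exact: diff_quot_nondecreasing.
exists (f x - f (x - v)) => _ [e /= e0 <-]; apply: diff_quot_ge => //.
by move: e0; rewrite in_itv/= andbT.
Qed.

(** * Sublinear functions and their minorants *)

Definition sublinear p :=
  (forall x y, p (x + y) <= p x + p y) /\
  (forall a x, 0 < a -> p (a *: x) = a * p x).

Lemma sublinear0 p : sublinear p -> p 0 = 0.
Proof. by case=> _ /(_ 2 0); rewrite ltr0n scaler0 => /(_ isT); lra. Qed.

Lemma sublinear_jensen p : sublinear p -> jensen p.
Proof.
move=> sp a b x y a0 b0 _; have [padd pscale] := sp.
apply: le_trans (padd _ _) _.
have E c z : 0 <= c -> p (c *: z) = c * p z.
  rewrite le_eqVlt => /predU1P[<-|/pscale ->//].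
  by rewrite scale0r mul0r sublinear0.
by rewrite !E.
Qed.

Lemma one_sided_deriv_sublinear f x : jensen f ->
  sublinear (one_sided_deriv f x).
Proof.
move=> cf; split=> [v w|a v a0].
  (* Each derivative on the right is an infimum over its own step, so independent [s] and [t]
     suffice. *)
  suff H s t : 0 < s -> 0 < t ->
      one_sided_deriv f x (v + w) <= diff_quot f x v s + diff_quot f x w t.
    rewrite -lerBlDr; apply: one_sided_deriv_ge => s s0.
    rewrite lerBlDr -lerBlDl; apply: one_sided_deriv_ge => t t0.
    by rewrite lerBlDl; exact: H.
  move=> s0 t0; have st0 : 0 < s + t by lra.
  (* the convex combination of x + s v and x + t w that has direction v + w *)
  pose e := s * t / (s + t).
  have e0 : 0 < e by rewrite divr_gt0// mulr_gt0.
  apply: le_trans (one_sided_deriv_le _ _ cf e0) _.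
  have ab1 : e / s + e / t = 1 by rewrite /e; field; rewrite !gt_eqF.
  have := cf _ _ (x + s *: v) (x + t *: w)
    (ltW (divr_gt0 e0 s0)) (ltW (divr_gt0 e0 t0)) ab1.
  rewrite !scalerDr !scalerA !divfK ?gt_eqF// addrACA -scalerDl ab1 scale1r.
  rewrite -scalerDr => H.
  rewrite /diff_quot ler_pdivrMr//.
  have -> : ((f (x + s *: v) - f x) / s + (f (x + t *: w) - f x) / t) * e =
      e / s * f (x + s *: v) + e / t * f (x + t *: w) - (e / s + e / t) * f x.
    by field; rewrite !gt_eqF.
  by rewrite ab1 mul1r lerB.
have E b e u : 0 < b -> 0 < e ->
    diff_quot f x (b *: u) e = b * diff_quot f x u (e * b).
  move=> b0 e0; rewrite /diff_quot scalerA; field; by rewrite !gt_eqF.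
apply/eqP; rewrite eq_le; apply/andP; split.
  rewrite -ler_pdivrMl//; apply: one_sided_deriv_ge => e e0.
  rewrite ler_pdivrMl//.
  have ea0 : 0 < e / a by rewrite divr_gt0.
  apply: le_trans (one_sided_deriv_le _ _ cf ea0) _.
  by rewrite E// divfK ?gt_eqF.
apply: one_sided_deriv_ge => e e0; rewrite E// ler_pM2l//.
by apply: one_sided_deriv_le => //; rewrite mulr_gt0.
Qed.

Lemma one_sided_deriv_sublinear_le p w v : sublinear p ->
  one_sided_deriv p w v <= p v.
Proof.
move=> sp; apply: le_trans (one_sided_deriv_le _ _ (sublinear_jensen sp) ltr01) _.
by rewrite /diff_quot divr1 scale1r; have := sp.1 w v; lra.
Qed.

Lemma one_sided_deriv_opp p w : sublinear p ->
  one_sided_deriv p w (- w) <= - p w.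
Proof.
move=> sp; apply: le_trans (one_sided_deriv_le _ _ (sublinear_jensen sp) ltr01) _.
by rewrite /diff_quot divr1 scale1r subrr (sublinear0 sp) sub0r.
Qed.

(* Passing to the directional derivative at [w] makes a sublinear function
   linear along [w] and keeps it linear along the directions already treated. *)
Lemma sublinear_minorant p (ws : seq V) : sublinear p ->
  exists2 q, sublinear q &
    (forall v, q v <= p v) /\ {in ws, forall w, q (- w) <= - q w}.
Proof.
elim: ws p => [|w ws IH] p sp; first by exists p.
have [q sq [qle qws]] := IH _ (one_sided_deriv_sublinear w (sublinear_jensen sp)).
exists q => //; split=> [v|u].
  by apply: le_trans (qle v) _; exact: one_sided_deriv_sublinear_le.
rewrite inE => /predU1P[->|/qws//].
apply: le_trans (qle _) _; apply: le_trans (one_sided_deriv_opp w sp) _.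
rewrite lerN2; apply: le_trans (qle w) _; exact: one_sided_deriv_sublinear_le.
Qed.

End OneSidedDerivative.

(** * Subgradients and directional derivatives on row vectors *)

Section RowVectors.
Context {R : realType} {n : nat}.
Implicit Types (L p : 'rV[R]_n -> R) (x y z v : 'rV[R]_n).

Lemma dotprodC x y : dotprod x y = dotprod y x.
Proof. by apply: eq_bigr => i _; rewrite mulrC. Qed.

Lemma dotprodZr (a : R) x y : dotprod x (a *: y) = a * dotprod x y.
Proof.
by rewrite /dotprod mulr_sumr; apply: eq_bigr => i _; rewrite mxE mulrCA.
Qed.

(** A finite-dimensional Hahn-Banach theorem: a minorant that is linear along every basis vector is
    a dot product. *)
Lemma sublinear_dotprod p : sublinear p ->
  exists y, forall v, dotprod y v <= p v.
Proof.
move=> sp; pose d i : 'rV[R]_n := delta_mx ord0 i.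
have [q [qadd qscale] [qle qN]] := sublinear_minorant (map d (enum 'I_n)) sp.
have q0 : q 0 = 0 by apply: sublinear0.
have qZ a i : q (a *: d i) <= a * q (d i).
  have [a0|a0|->] := ltgtP a 0; last by rewrite scale0r mul0r q0.
    rewrite -[a]opprK scaleNr -scalerN qscale ?oppr_gt0// [leRHS]mulNr -mulrN.
    by rewrite ler_pM2l ?oppr_gt0// qN// map_f// mem_enum.
  by rewrite qscale.
have qdot v : q v <= dotprod (\row_i q (d i)) v.
  rewrite {1}[v]row_sum_delta /dotprod.
  elim/big_ind2: _ => [|a b a' b' H1 H2|i _]; first by rewrite q0.
    by apply: le_trans (qadd _ _) _; exact: lerD.
  by rewrite mxE mulrC.
(* Applying [qdot] to [- v] turns the upper bound on [q] into the lower one, since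
   [0 <= q v + q (- v)]. *)
exists (\row_i q (d i)) => v; apply: le_trans (qle v).
have := qdot (- v); rewrite -scaleN1r dotprodZr scaleN1r.
by have := qadd v (- v); rewrite subrr q0; lra.
Qed.

Lemma dir_derivE L x v : jensen L -> dir_deriv L x v = one_sided_deriv L x v.
Proof. by move=> cL; apply/cvg_lim => //; exact: diff_quot_cvg. Qed.

Lemma subdifferential_dir_deriv_le L x y v : jensen L ->
  subdifferential L x y -> dotprod y v <= dir_deriv L x v.
Proof.
move=> cL Hy; rewrite dir_derivE//; apply: one_sided_deriv_ge => e e0.
rewrite /diff_quot ler_pdivlMr//; have := Hy (x + e *: v).
by rewrite [X in dotprod _ X]addrC addKr dotprodZr; lra.
Qed.

(** Choose [y] below the derivative at [v] of the sublinear map [L'(x, .)]. That derivative is at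
    most [L'(x, .)], which makes [y] a subgradient, and its value at [- v] is at most [- L'(x, v)],
    which gives the inequality. *)
Lemma subdifferential_dir_deriv_attained L x v : jensen L ->
  exists2 y, subdifferential L x y & dir_deriv L x v <= dotprod y v.
Proof.
move=> cL; rewrite dir_derivE//.
have sD := one_sided_deriv_sublinear x cL.
have [y Hy] :=
  sublinear_dotprod (one_sided_deriv_sublinear v (sublinear_jensen sD)).
exists y => [z /=|].
  have := le_trans (Hy (z - x)) (one_sided_deriv_sublinear_le v (z - x) sD).
  move=> /le_trans/(_ (one_sided_deriv_le _ _ cL ltr01)).
  by rewrite /diff_quot divr1 scale1r addrCA subrr addr0; lra.
have := le_trans (Hy (- v)) (one_sided_deriv_opp v sD).
by rewrite -scaleN1r dotprodZr; lra.
Qed.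

(** The differential is linear in [v], and the right-hand limit agrees with the two-sided one. *)
Lemma dotprod_gradient L x v : differentiable L x ->
  dotprod (gradient L x) v = dir_deriv L x v.
Proof.
move=> dL; transitivity ('D_v L x).
  rewrite deriveE// {2}[v]row_sum_delta linear_sum; apply: eq_bigr => i _.
  by rewrite linearZ mxE deriveE// mulrC.
have /cvg_at_rightE : derivable L x v by exact: diff_derivable.
rewrite /derive /dir_deriv => ->; congr lim.
set g := (X in X @ _ = _); set h := (X in _ = X @ _).
suff -> : g = h by [].
by apply/funext => e; rewrite /g /h /= mulrC (addrC x).
Qed.

Lemma sup_gradientE L : (forall x, differentiable L x) ->
  sup_gradient L = sup_dir_deriv L.
Proof.
by move=> dL; congr ereal_sup; apply: eq_imagel => x _; rewrite dotprod_gradient.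
Qed.

Lemma sup_dir_derivE L : (forall x, 0 <= L x) -> jensen L ->
  sup_dir_deriv L = sup_subdiff L.
Proof.
move=> L0 cL; apply/eqP; rewrite eq_le; apply/andP; split.
  apply: ge_ereal_sup => _ [x x0 <-].
  have [y Hy le_y] := subdifferential_dir_deriv_attained x x cL.
  apply: (@le_trans _ _ (dotprod x y / L x)%:E).
    by rewrite lee_fin ler_wpM2r ?invr_ge0// dotprodC.
  apply: le_trans (ereal_sup_ubound _); last by exists x.
  by apply: ereal_sup_ubound; exists y.
apply: ge_ereal_sup => _ [x x0 <-]; apply: ge_ereal_sup => _ [y Hy <-].
apply: (@le_trans _ _ (dir_deriv L x x / L x)%:E).
  rewrite lee_fin ler_wpM2r ?invr_ge0// dotprodC.
  exact: subdifferential_dir_deriv_le.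
by apply: ereal_sup_ubound; exists x.
Qed.

(** * The Delta_2-condition and the bound by [p_plus] *)

Section Gauge.
Variable L : 'rV[R]_n -> R.
Hypothesis L_ge0 : forall x, 0 <= L x.
Hypothesis L_jensen : jensen L.
Hypothesis L_0 : L 0 = 0.
Hypothesis L_gt0 : forall x, x != 0 -> 0 < L x.

Lemma gauge_scale_le (a : R) x : 0 <= a -> a <= 1 -> L (a *: x) <= L x.
Proof.
move=> a0 a1; have b0 : 0 <= 1 - a by lra.
have := L_jensen x 0 a0 b0; rewrite scaler0 L_0 mulr0 !addr0.
move=> /(_ ltac:(lra)) /le_trans; apply.
by rewrite ler_piMl.
Qed.

Lemma gauge_scale_le_Delta2 (C e : R) x :
  (forall x, L (2 *: x) <= C * L x) -> 0 <= e -> e <= 1 ->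
  L ((1 + e) *: x) <= C * L x.
Proof.
move=> LC e0 e1; apply: le_trans (LC x).
have -> : (1 + e) *: x = ((1 + e) / 2) *: (2 *: x).
  by rewrite scalerA divfK// pnatr_eq0.
by apply: gauge_scale_le; lra.
Qed.

Lemma Delta2_sup_dir_deriv : two_sided_Delta2 L -> (sup_dir_deriv L < +oo)%E.
Proof.
move=> [C LC]; apply: (@le_lt_trans _ _ (C - 1)%:E); last exact: ltry.
apply: ge_ereal_sup => _ [x x0 <-].
rewrite lee_fin ler_pdivrMr ?L_gt0// dir_derivE//.
apply: le_trans (one_sided_deriv_le _ _ L_jensen ltr01) _.
rewrite /diff_quot divr1 scale1r -[x + x]/(x *+ 2) -scaler_nat.
by have := LC x; lra.
Qed.

(* The tangent line at [x] in direction [x], followed back to [(1 - 1/(2M)) x],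
   shows that [L] at most doubles between that point and [x]. *)
Lemma gauge_doubling (M : R) x : 1 <= M ->
  (forall x, x != 0 -> dir_deriv L x x <= M * L x) ->
  L x <= 2 * L ((1 - (2 * M)^-1) *: x).
Proof.
move=> M1 HM; have [->|x0] := eqVneq x 0; first by rewrite scaler0 L_0 mulr0.
(* With this [d] the tangent line drops by at most [L x / 2] from [x] to [(1 - d) *: x]. *)
set d := (2 * M)^-1.
have d0 : 0 < d by rewrite invr_gt0; lra.
have [y Hy _] := subdifferential_dir_deriv_attained x x L_jensen.
have yx := subdifferential_dir_deriv_le x L_jensen Hy.
have := Hy ((1 - d) *: x).
rewrite -{3}[x]scale1r -scalerBl addrAC subrr sub0r dotprodZr.
have : d * dotprod y x <= d * (M * L x).
  by rewrite ler_pM2l//; exact: le_trans yx (HM _ x0).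
have -> : d * (M * L x) = L x / 2.
  by rewrite /d; field; apply: lt0r_neq0; lra.
lra.
Qed.

Lemma sup_dir_deriv_Delta2 : (sup_dir_deriv L < +oo)%E -> two_sided_Delta2 L.
Proof.
move=> supfin.
have [M M1 HM] : exists2 M : R, 1 <= M &
    forall x, x != 0 -> dir_deriv L x x <= M * L x.
  have [M supM] : exists M : R, (sup_dir_deriv L <= M%:E)%E.
    (* The value -oo is the empty supremum, which arises for [n = 0]. *)
    case: (sup_dir_deriv L) supfin => [r _|//|_]; first by exists r.
    by exists 0; rewrite leNye.
  (* The maximum with 1 keeps the contraction factor [r] below strictly between 0 and 1. *)
  exists (Num.max 1 M); first by rewrite le_max lexx.
  move=> x x0; rewrite -ler_pdivrMr ?L_gt0// le_max; apply/orP; right.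
  by rewrite -lee_fin; apply: le_trans supM; apply: ereal_sup_ubound; exists x.
set r := 1 - (2 * M)^-1.
have d0 : 0 < (2 * M)^-1 by rewrite invr_gt0; lra.
have d1 : (2 * M)^-1 < 1 by rewrite invf_lt1; lra.
have r0 : 0 < r by rewrite /r; lra.
have r1 : `|r| < 1 by rewrite gtr0_norm// /r; lra.
have iterd m x : L x <= 2 ^+ m * L (r ^+ m *: x).
  elim: m x => [|m IH] x; first by rewrite !expr0 scale1r mul1r.
  apply: le_trans (IH x) _; rewrite exprSr (exprS r) -mulrA -scalerA.
  by rewrite ler_pM2l ?exprn_gt0//; exact: gauge_doubling.
have half : 0 < 2^-1 :> R by rewrite invr_gt0.
(* For such [m], [r ^+ m *: (2 *: x)] is [x] scaled by a factor at most 1, so [2 ^+ m] serves as the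
   Delta_2 constant. *)
have [m rm] : exists m, r ^+ m <= 2^-1.
  have /cvgr_le/(_ _ half)[m _ H] := cvg_expr r1.
  by exists m; apply: H => /=.
exists (2 ^+ m) => x; apply: le_trans (iterd m _) _.
rewrite ler_pM2l ?exprn_gt0// scalerA.
by apply: gauge_scale_le; [rewrite mulr_ge0// exprn_ge0// ltW|lra].
Qed.

Lemma sup_dir_deriv_le_p_plus : two_sided_Delta2 L ->
  (sup_dir_deriv L <= (p_plus L)%:E)%E.
Proof.
move=> [C LC]; apply: ge_ereal_sup => _ [x x0 <-]; rewrite lee_fin.
pose F e := fine (Phi L (1 + e)).
(* Delta_2 bounds [Phi L] by [C] on [1, 2], and the nonzero [x] keeps the supremum above -oo. *)
have Phifin e : 0 <= e -> e <= 1 -> Phi L (1 + e) = (F e)%:E.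
  move=> e0 e1; rewrite /F fineK// fin_numElt; apply/andP; split.
    apply: (@lt_le_trans _ _ (L ((1 + e) *: x) / L x)%:E); first exact: ltNyr.
    by apply: ereal_sup_ubound; exists x.
  apply: (@le_lt_trans _ _ C%:E); last exact: ltry.
  apply: ge_ereal_sup => _ [z z0 <-]; rewrite lee_fin ler_pdivrMr ?L_gt0//.
  exact: gauge_scale_le_Delta2.
have F_ub e z : 0 <= e -> e <= 1 -> z != 0 -> L ((1 + e) *: z) <= F e * L z.
  move=> e0 e1 z0; rewrite -ler_pdivrMr ?L_gt0// -lee_fin -Phifin//.
  by apply: ereal_sup_ubound; exists z.
have F_le e c : 0 <= e -> e <= 1 ->
    (forall z, z != 0 -> L ((1 + e) *: z) <= c * L z) -> F e <= c.
  move=> e0 e1 H; rewrite -lee_fin -Phifin//; apply: ge_ereal_sup => _ [z z0 <-].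
  by rewrite lee_fin ler_pdivrMr ?L_gt0// H.
have F0 : fine (Phi L 1) = 1.
  have -> : Phi L 1 = (F 0)%:E by rewrite -Phifin// addr0.
  apply/eqP; rewrite eq_le /= F_le//=; last first.
    by move=> z _; rewrite addr0 scale1r mul1r.
  have := F_ub 0 x (lexx _) ler01 x0.
  by rewrite addr0 scale1r -{1}[L x]mul1r ler_pM2r// L_gt0.
have Lquot (e : R) z : e != 0 ->
    L ((1 + e) *: z) = diff_quot L z z e * e + L z.
  by move=> e0; rewrite /diff_quot divfK// subrK scalerDl scale1r.
have Fquot e z : 0 < e -> e <= 1 -> z != 0 ->
    diff_quot L z z e <= (F e - 1) / e * L z.
  move=> e0 e1 z0; rewrite mulrAC ler_pdivlMr//.
  by have := F_ub e z (ltW e0) e1 z0; rewrite Lquot ?gt_eqF//; lra.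
(* The quotients of [F] inherit monotonicity on ]0, 1] from those of [L], and [L'(x, x) / L x]
   bounds them below; so the [lim] in [p_plus] is a true limit. *)
have Fcvg : cvg ((F e - 1) / e @[e --> 0^'+]).
  apply/cvg_ex; eexists; apply: (@nondecreasing_at_right_cvgr _ _ _ (BRight 1)).
  - by rewrite bnd_simp.
  - move=> s t; rewrite !in_itv/= => /andP[s0 s1] /andP[t0 t1] st.
    rewrite ler_pdivrMr// lerBlDr; apply: F_le => //; first exact: ltW.
    move=> z z0; rewrite Lquot ?gt_eqF// mulrDl mul1r lerD2r [leRHS]mulrAC.
    rewrite ler_pM2r//; apply: le_trans (Fquot _ _ t0 t1 z0).
    exact: diff_quot_nondecreasing.
  - exists (one_sided_deriv L x x / L x) => _ [e + <-].
    rewrite /= in_itv/= => /andP[e0 e1]; rewrite ler_pdivrMr ?L_gt0//.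
    apply: le_trans (Fquot _ _ e0 e1 x0); exact: one_sided_deriv_le.
rewrite /p_plus F0; apply: limr_ge => //; near=> e.
have e0 : 0 < e by near: e; exact: nbhs_right_gt.
have e1 : e <= 1 by near: e; exact: nbhs_right_le.
rewrite ler_pdivrMr ?L_gt0// dir_derivE//.
apply: le_trans (Fquot _ _ e0 e1 x0); exact: one_sided_deriv_le.
Unshelve. all: by end_near.
Qed.

End Gauge.
End RowVectors.

Theorem proposition7p1 (R : realType) (n : nat) (L : 'rV[R]_n -> R)
    (L_ge0 : forall x : 'rV[R]_n, 0 <= L x)
    (L_convex : convex_function [set: 'rV[R]_n] L)
    (L_0 : L 0 = 0)
    (L_gt0 : forall x : 'rV[R]_n, x != 0 -> 0 < L x) :
  [/\ sup_dir_deriv L = sup_subdiff L,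
      two_sided_Delta2 L <-> (sup_dir_deriv L < +oo)%E,
      two_sided_Delta2 L ->
        (sup_dir_deriv L <= (p_plus L)%:E)%E /\
        (sup_subdiff L <= (p_plus L)%:E)%E &
      (forall x : 'rV[R]_n, differentiable L x) ->
        (two_sided_Delta2 L <-> (sup_gradient L < +oo)%E)].
Proof.
have L_jensen := convex_function_jensen L_convex.
have supE := sup_dir_derivE L_ge0 L_jensen.
have Delta2E : two_sided_Delta2 L <-> (sup_dir_deriv L < +oo)%E.
  by split; [exact: Delta2_sup_dir_deriv|exact: sup_dir_deriv_Delta2].
split=> // [LD|dL]; last by rewrite sup_gradientE.
by rewrite -supE; split; exact: sup_dir_deriv_le_p_plus.
Qed.
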